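(* Let $\Bbbk$ be a commutative ring. If every contraction $(f\colon A\to B,\ g\colon B\to A,\ h\colon A\to A)$ of chain complexes over $\Bbbk$ can be extended to a symmetric thick contraction $(\mathbf{f},\mathbf{g},\mathbf{h})$ (so $\mathbf{f}_1=f$, $\mathbf{g}_1=g$, $\mathbf{h}_1=h$), then necessarily $\mathbb{Q}\subseteq\Bbbk$.
   Context: Chain complexes are unbounded complexes over $\Bbbk$ with differential of degree $-1$; the Koszul sign rule is used. A contraction of chain complexes consists of maps $f\colon A\to B$, $g\colon B\to A$ of degree $0$ and $h\colon A\to A$ of degree $1$ with $\partial(f)=0$, $\partial(g)=0$, $\partial(h)=gf-1_A$, $fg=1_B$, $fh=0$, $hh=0$, $hg=0$. A thick map $\mathbf{f}\colon A\to B$ is a sequence of maps $\mathbf{f}_n\colon A^{\otimes n}\to B^{\otimes n}$, $n\ge0$, all of the same degree; it is symmetric if each $\mathbf{f}_n$ is $\Sigma_n$-equivariant for permutation of tensor factors. Composition, sums and $\partial(\mathbf{f})_n=d_{B^{\otimes n}}\mathbf{f}_n-(-1)^{|\mathbf{f}|}\mathbf{f}_nd_{A^{\otimes n}}$ are levelwise; $\mathbf{1}_n=1$, $\mathbf{0}_n=0$. A symmetric thick contraction consists of symmetric thick maps $\mathbf{f}\colon A\to B$, $\mathbf{g}\colon B\to A$, $\mathbf{h}\colon A\to A$ of degrees $0,0,1$ with $\partial(\mathbf{f})=\mathbf{0}$, $\partial(\mathbf{g})=\mathbf{0}$, $\partial(\mathbf{h})=\mathbf{g}\mathbf{f}-\mathbf{1}$,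 $\mathbf{f}\mathbf{g}=\mathbf{1}$, $\mathbf{f}\mathbf{h}=\mathbf{0}$, $\mathbf{h}\mathbf{h}=\mathbf{0}$, $\mathbf{h}\mathbf{g}=\mathbf{0}$. $\mathbb{Q}\subseteq\Bbbk$ means that $\Bbbk$ contains the rationals as a subring, i.e. every positive integer is invertible in $\Bbbk$. *)

(* Defs.v *)
From HB Require Import structures.
From mathcomp Require Import all_boot all_order all_algebra perm boolp.

Set Implicit Arguments.
Unset Strict Implicit.
Unset Printing Implicit Defensive.

Import GRing.Theory.
Local Open Scope ring_scope.
Local Open Scope quotient_scope.

(* Q contained in k, in the sense that every positive integer is invertible in
   k; the zero ring qualifies. *)
Definition contains_rationals (k : comPzRingType) : Prop :=
  forall n : nat, (0 < n)%N -> exists x : k, n%:R * x = 1.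

(* A k-linear map of degree p between graded k-modules is given by all its
   components A i -> B j, those with j <> i + p being zero. This avoids
   transports along equalities of degrees such as i + 1 - 1 = i. *)
Record gmap (k : comPzRingType) (A B : int -> lmodType k) (p : int) := GMap {
  gmap_fun :> forall i j, {linear A i -> B j};
  gmap_deg : forall i j, j != i + p -> forall a, gmap_fun i j a = 0
}.

Record chain_complex (k : comPzRingType) := ChainComplex {
  cc_mod :> int -> lmodType k;
  cc_d : gmap cc_mod cc_mod (- 1);
  cc_dd : forall i j l (a : cc_mod i), cc_d j l (cc_d i j a) = 0
}.

(* The component A i -> B j of the differential d_B f - (-1)^p f d_A. *)
Definition hom_diff (k : comPzRingType) (A B : chain_complex k) (p : int)
    (f : gmap A B p) (i j : int) (a : A i) : B j :=
  cc_d B (j + 1) j (f i (j + 1) a)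
  - (-1) ^+ `|p|%N *: f (i - 1) j (cc_d A i (i - 1) a).

(* In contr_dh and contr_fg only the components i -> i matter, both sides being
   zero on the other ones. *)
Record contraction (k : comPzRingType) (A B : chain_complex k)
    (f : gmap A B 0) (g : gmap B A 0) (h : gmap A A 1) : Prop := Contraction {
  contr_df : forall i j (a : A i), hom_diff f j a = 0;
  contr_dg : forall i j (b : B i), hom_diff g j b = 0;
  contr_dh : forall i (a : A i), hom_diff h i a = g i i (f i i a) - a;
  contr_fg : forall i (b : B i), f i i (g i i b) = b;
  contr_fh : forall i j (a : A i), f j j (h i j a) = 0;
  contr_hh : forall i j l (a : A i), h j l (h i j a) = 0;
  contr_hg : forall i j (b : B i), h i j (g i i b) = 0
}.

Section TensorPower.
Variables (k : comPzRingType) (A : int -> lmodType k) (n : nat).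

(* Words a_1 ... a_n of homogeneous elements; an element of degree p is
   Tagged A (a : A p). *)
Definition hword := {ffun 'I_n -> {p : int & A p}}.

Implicit Types (x : hword) (i : 'I_n).

Definition wdeg x : int := \sum_(i < n) tag (x i).

Definition wset x i (y : {p : int & A p}) : hword :=
  [ffun j => if j == i then y else x j].

(* The multilinear maps on the words of total degree m, extended by zero to
   all words. *)
Definition multilinear (m : int) (M : lmodType k) (phi : hword -> M) : Prop :=
  (forall x, wdeg x != m -> phi x = 0) /\
  (forall x i (p : int) (r : k) (u v : A p),
     phi (wset x i (Tagged A (r *: u + v))) =
     r *: phi (wset x i (Tagged A u)) + phi (wset x i (Tagged A v))).

(* The degree m part of the n-th tensor power is the direct sum of the
   A p_1 (x) ... (x) A p_n over all p_1 + ... + p_n = m, that is, the universal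
   target of the multilinear maps above. It is realized as the formal linear
   combinations of words, two of them being identified when no multilinear map
   separates them; words of total degree different from m are thereby killed. *)
Definition fcomb := seq (k * hword).

Definition feval (M : lmodType k) (phi : hword -> M) (s : fcomb) : M :=
  \sum_(c <- s) c.1 *: phi c.2.

Definition feq (m : int) : rel fcomb := fun s t =>
  `[< forall (M : lmodType k) (phi : hword -> M),
        multilinear m phi -> feval phi s = feval phi t >].

Lemma feqP m s t :
  reflect (forall (M : lmodType k) (phi : hword -> M),
             multilinear m phi -> feval phi s = feval phi t) (feq m s t).
Proof. exact: asboolP. Qed.

Lemma feq_is_equiv m : equiv_class_of (feq m).
Proof.
split=> [s|s t|t s u].
- by apply/feqP.
- by apply/feqP/feqP => st M phi h; rewrite (st M phi h).
- by move=> /feqP st /feqP tu; apply/feqP => M phi h; rewrite st ?tu.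
Qed.

Canonical feq_equiv m := EquivRelPack (feq_is_equiv m).
Canonical feq_encModRel m := defaultEncModRel (feq m).

Definition tmod (m : int) := {eq_quot (feq m)}.

HB.instance Definition _ m := Choice.on (tmod m).
HB.instance Definition _ m := EqQuotient.on (tmod m).

Definition tcls m (s : fcomb) : tmod m := \pi_(tmod m) s.

Lemma tcls_eq m s t :
  (forall (M : lmodType k) (phi : hword -> M),
     multilinear m phi -> feval phi s = feval phi t) ->
  tcls m s = tcls m t.
Proof. by move=> st; apply/eqP; rewrite /tcls piE; apply/feqP. Qed.

Lemma feval_repr m (M : lmodType k) (phi : hword -> M) s :
  multilinear m phi -> feval phi (repr (tcls m s)) = feval phi s.
Proof.
move=> h; suff /feqP /(_ M phi h) : feq m (repr (tcls m s)) s by [].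
by have := reprK (tcls m s) => /eqP; rewrite {2}/tcls piE.
Qed.

Lemma tcls_repr m (t : tmod m) : tcls m (repr t) = t.
Proof. exact: reprK. Qed.

Definition fscale (r : k) (s : fcomb) : fcomb := [seq (r * c.1, c.2) | c <- s].

Lemma feval_nil (M : lmodType k) (phi : hword -> M) : feval phi [::] = 0.
Proof. by rewrite /feval big_nil. Qed.

Lemma feval_cat (M : lmodType k) (phi : hword -> M) s t :
  feval phi (s ++ t) = feval phi s + feval phi t.
Proof. by rewrite /feval big_cat. Qed.

Lemma feval_scale (M : lmodType k) (phi : hword -> M) r s :
  feval phi (fscale r s) = r *: feval phi s.
Proof.
rewrite /feval /fscale big_map scaler_sumr.
by apply: eq_bigr => c _; rewrite scalerA.
Qed.

Lemma feval1 (M : lmodType k) (phi : hword -> M) x :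
  feval phi [:: (1, x)] = phi x.
Proof. by rewrite /feval big_seq1 scale1r. Qed.

Definition tzero m : tmod m := tcls m [::].
Definition tadd m (t u : tmod m) : tmod m := tcls m (repr t ++ repr u).
Definition tscale m (r : k) (t : tmod m) : tmod m := tcls m (fscale r (repr t)).
Definition topp m (t : tmod m) : tmod m := tscale (-1) t.

Local Ltac tmod_solve :=
  move=> *; rewrite -[RHS]tcls_repr; apply: tcls_eq => *;
  match goal with ml : multilinear _ _ |- _ =>
    rewrite /tadd /topp /tscale /tzero;
    rewrite ?(feval_cat, feval_scale, feval_repr _ ml)
  end.

Fact taddA m : associative (@tadd m).
Proof. by tmod_solve; rewrite addrA. Qed.

Fact taddC m : commutative (@tadd m).
Proof. by tmod_solve; rewrite addrC. Qed.

Fact tadd0 m : left_id (tzero m) (@tadd m).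
Proof. by tmod_solve; rewrite feval_nil add0r. Qed.

Fact taddN m : left_inverse (tzero m) (@topp m) (@tadd m).
Proof. by tmod_solve; rewrite feval_nil scaleN1r addNr. Qed.

HB.instance Definition _ m :=
  GRing.isZmodule.Build (tmod m) (@taddA m) (@taddC m) (@tadd0 m) (@taddN m).

Fact tscaleA m r s (t : tmod m) : tscale r (tscale s t) = tscale (r * s) t.
Proof. by tmod_solve; rewrite scalerA. Qed.

Fact tscale1 m : left_id 1 (@tscale m).
Proof. by tmod_solve; rewrite scale1r. Qed.

Fact tscaleDr m : right_distributive (@tscale m) +%R.
Proof. by tmod_solve; rewrite scalerDr. Qed.

Fact tscaleDl m (t : tmod m) : {morph (@tscale m)^~ t : r s / r + s}.
Proof. by tmod_solve; rewrite scalerDl. Qed.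

HB.instance Definition _ m :=
  GRing.Zmodule_isLmodule.Build k (tmod m) (@tscaleA m) (@tscale1 m)
    (@tscaleDr m) (@tscaleDl m).

(* The pure tensor a_1 (x) ... (x) a_n in degree m; it is 0 unless
   wdeg x = m. *)
Definition tpure m x : tmod m := tcls m [:: (1, x)].

Lemma feval_tpure m s : feval (tpure m) s = tcls m s.
Proof.
elim: s => [|[r x] s IH]; first by rewrite feval_nil.
rewrite /feval big_cons -/(feval _ _) IH /=.
apply: tcls_eq => M phi h.
rewrite feval_cat !feval_repr // feval_scale feval_repr // feval1.
by rewrite /feval big_cons.
Qed.

Lemma tpure_multilinear m : multilinear m (tpure m).
Proof.
split=> [x xm|x i p r u v].
  by apply: tcls_eq => M phi h; rewrite feval1 feval_nil h.1.
apply: tcls_eq => M phi h.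
by rewrite feval_cat !feval_repr // feval_scale feval_repr // !feval1 h.2.
Qed.

(* Universal property of the tensor power. *)
Section Lift.
Variables (m : int) (M : lmodType k) (phi : hword -> M).
Hypothesis phi_ml : multilinear m phi.

Definition tlift_fun (t : tmod m) : M := feval phi (repr t).

Lemma tlift_is_linear : linear tlift_fun.
Proof.
move=> r t u; rewrite /tlift_fun feval_repr // feval_cat feval_repr //.
by rewrite feval_scale.
Qed.

HB.instance Definition _ :=
  GRing.isLinear.Build k (tmod m) M *:%R tlift_fun tlift_is_linear.

Definition tlift : {linear tmod m -> M} := tlift_fun.

Lemma tliftE x : tlift (tpure m x) = phi x.
Proof. by rewrite /tlift /= /tlift_fun feval_repr // feval1. Qed.

End Lift.

Lemma tmod_ind m (P : tmod m -> Prop) :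
  P 0 -> (forall r x t, P t -> P (r *: tpure m x + t)) -> forall t, P t.
Proof.
move=> P0 PS t; rewrite -(tcls_repr t) -feval_tpure.
elim: (repr t) => [|[r x] s IH]; first by rewrite feval_nil.
by rewrite /feval big_cons; apply: PS.
Qed.

Lemma tmod_ext m (M : lmodType k) (F G : {linear tmod m -> M}) :
  (forall x, F (tpure m x) = G (tpure m x)) -> F =1 G.
Proof.
move=> FG; apply: tmod_ind => [|r x t IH]; first by rewrite !linear0.
by rewrite !linearP FG IH.
Qed.

End TensorPower.

(* The isomorphism of A i with the degree i part of the first tensor power. *)
Section TensorOne.
Variables (k : comPzRingType) (A : int -> lmodType k).

Definition tone i (a : A i) : tmod A 1 i := tpure i [ffun=> Tagged A a].

Lemma tone_is_linear i : linear (@tone i).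
Proof.
have E c : tone c = tpure i (wset [ffun=> Tagged A (0 : A i)] ord0 (Tagged A c)).
  by congr tpure; apply/ffunP => j; rewrite !ffunE (ord1 j) eqxx.
by move=> r a b; rewrite !E (tpure_multilinear A 1 i).2.
Qed.

Lemma tone_bij i : bijective (@tone i).
Proof.
pose coef (y : {p : int & A p}) : A i := @untag int (fun p => A p) _ 0 i id y.
have coefE (a : A i) : coef (Tagged A a) = a.
  by rewrite /coef (untagE _ _ (erefl : tag (Tagged A a) = i)).
have coef0 y : tag y != i -> coef y = 0 by exact: untag_dflt.
pose phi (x : hword A 1) : A i := coef (x ord0).
have phi_ml : multilinear i phi.
  split=> [x|x j p r u v]; first by rewrite /wdeg big_ord1; apply: coef0.
  rewrite /phi !ffunE (ord1 j) eqxx; have [pi|pi] := eqVneq p i.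
    by case: i / pi coef coefE {coef0 phi} => coef coefE; rewrite !coefE.
  by rewrite !coef0 // scaler0 addr0.
have tone0 : tone (0 : A i) = 0.
  have := tone_is_linear 1 (0 : A i) 0.
  by rewrite !scale1r addr0 => /eqP; rewrite -subr_eq subrr eq_sym => /eqP.
exists (tlift phi_ml) => [a|t]; first by rewrite tliftE /phi ffunE coefE.
elim/tmod_ind: t => [|r x t IH]; first by rewrite linear0.
rewrite linearP tone_is_linear IH tliftE; congr (_ *: _ + _).
rewrite /phi; have -> : x = [ffun=> x ord0].
  by apply/ffunP => j; rewrite ffunE (ord1 j).
rewrite ffunE; case: (x ord0) => p a; have [pi|pi] := eqVneq p i.
  by case: i / pi coef coefE {coef0 phi phi_ml tone0 t IH} => coef ->.
rewrite coef0 // tone0 (tpure_multilinear A 1 i).1 //.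
by rewrite /wdeg big_ord1 ffunE.
Qed.

End TensorOne.

Section TensorComplex.
Variables (k : comPzRingType) (A : chain_complex k) (n : nat).

Implicit Types (x : hword A n) (i j : 'I_n).

Definition dletter (y : {p : int & A p}) : {p : int & A p} :=
  Tagged (cc_mod A) (cc_d A (tag y) (tag y - 1) (tagged y)).

Definition wdiff x i : hword A n := wset x i (dletter (x i)).

(* The Koszul sign of moving d past the first i letters. *)
Definition wsign x i : k := (-1) ^+ (\sum_(j < n | (j < i)%N) `|tag (x j)|)%N.

Definition tdiff_word (m m' : int) x : tmod A n m' :=
  if m' == m - 1 then \sum_(i < n) wsign x i *: tpure m' (wdiff x i) else 0.

Lemma wset_wset x i y z : wset (wset x i y) i z = wset x i z.
Proof. by apply/ffunP => j; rewrite !ffunE; case: eqP. Qed.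

Lemma wsetC x i j y z :
  i != j -> wset (wset x i y) j z = wset (wset x j z) i y.
Proof.
move=> ij; apply/ffunP => l; rewrite !ffunE.
by case: (eqVneq l j) => // ->; rewrite eq_sym (negPf ij).
Qed.

Lemma wset_eq x i y : wset x i y i = y.
Proof. by rewrite ffunE eqxx. Qed.

Lemma wset_ne x i j y : j != i -> wset x i y j = x j.
Proof. by rewrite ffunE => /negPf ->. Qed.

Lemma wdeg_wset x i y : wdeg (wset x i y) = wdeg x - tag (x i) + tag y.
Proof.
rewrite /wdeg (bigD1 i) //= [in RHS](bigD1 i) //= wset_eq.
rewrite (eq_bigr (fun j => tag (x j))); last by move=> j ji; rewrite wset_ne.
by rewrite addrC; congr (_ + _); rewrite addrAC subrr add0r.
Qed.

Lemma wdeg_wdiff x i : wdeg (wdiff x i) = wdeg x - 1.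
Proof. by rewrite wdeg_wset /= addrA subrK. Qed.

Lemma wsign_tag x x' i :
  (forall j, tag (x j) = tag (x' j)) -> wsign x i = wsign x' i.
Proof. by move=> xx'; congr (_ ^+ _); apply: eq_bigr => j _; rewrite xx'. Qed.

Lemma tdiff_word_multilinear m m' : multilinear m (tdiff_word m m').
Proof.
rewrite /tdiff_word; case: (eqVneq m' (m - 1)) => [->|_]; last first.
  by split=> // *; rewrite scaler0 addr0.
have [ml0 ml] := tpure_multilinear A n (m - 1).
split=> [x xm|x i0 p r u v].
  apply: big1 => i _; rewrite ml0 ?scaler0 // wdeg_wdiff.
  by apply: contra xm => /eqP/addIr ->.
rewrite scaler_sumr -big_split /=; apply: eq_bigr => i _.
rewrite scalerA mulrC -scalerA.
set s := wsign _ _.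
have -> : wsign (wset x i0 (Tagged (cc_mod A) u)) i = s.
  by apply: wsign_tag => j; rewrite !ffunE; case: eqP.
have -> : wsign (wset x i0 (Tagged (cc_mod A) v)) i = s.
  by apply: wsign_tag => j; rewrite !ffunE; case: eqP.
rewrite -scalerDr; congr (_ *: _).
have [->|ne] := eqVneq i i0.
  by rewrite /wdiff !wset_wset !wset_eq /dletter /= linearP ml.
by rewrite /wdiff !(wset_ne _ _ ne) !(wsetC _ _ _ (_ : i0 != i)) 1?eq_sym // ml.
Qed.

Definition tdiff_fun (m m' : int) : {linear tmod A n m -> tmod A n m'} :=
  tlift (tdiff_word_multilinear m m').

Lemma tdiff_funE m m' x : tdiff_fun m m' (tpure m x) = tdiff_word m m' x.
Proof. exact: tliftE. Qed.

Lemma tdiff_deg m m' : m' != m + - 1 -> forall t, tdiff_fun m m' t = 0.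
Proof.
move=> mm' t; elim/tmod_ind: t => [|r x t IH]; first by rewrite linear0.
by rewrite linearP IH tdiff_funE /tdiff_word (negPf mm') scaler0 addr0.
Qed.

Definition tdiff : gmap (tmod A n) (tmod A n) (- 1) := GMap tdiff_deg.

Lemma wset0_tpure x i p m : tpure m (wset x i (Tagged (cc_mod A) (0 : A p))) = 0.
Proof.
have := (tpure_multilinear A n m).2 x i p 1 0 0.
by rewrite !scale1r addr0 => /eqP; rewrite -subr_eq subrr eq_sym => /eqP.
Qed.

Lemma signB1 (t : int) : (-1) ^+ `|t - 1|%N = - (-1) ^+ `|t|%N :> k.
Proof.
case: t => [[|t]|t].
- by rewrite sub0r abszN expr1 expr0.
- have -> : (`|Posz t.+1 - 1| = t)%N by rewrite -addn1 PoszD addrK.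
  by rewrite /= exprS mulN1r opprK.
- have -> : (`|Negz t - 1| = t.+2)%N by rewrite NegzE -opprD abszN -PoszD addn1.
  by rewrite /= exprS mulN1r.
Qed.

Lemma wsign_wdiff x i j :
  wsign (wdiff x i) j = if (i < j)%N then - wsign x j else wsign x j.
Proof.
rewrite /wsign; case: ifP => ij; last first.
  congr (_ ^+ _); apply: eq_bigr => l lj; rewrite wset_ne //.
  by apply: contraFneq ij => <-.
rewrite (bigD1 i) //= [in RHS](bigD1 i) //= !exprD wset_eq /= signB1 mulNr.
congr (- (_ * _ ^+ _)); apply: eq_bigr => l /andP[_ li].
by rewrite wset_ne.
Qed.

Lemma tdiff_fun_word m m' m'' x : tdiff_fun m' m'' (tdiff_word m m' x) = 0.
Proof.
rewrite /tdiff_word; case: eqP => [_|_]; last by rewrite linear0.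
rewrite (linear_sum (tdiff_fun m' m'')).
case: (eqVneq m'' (m' - 1)) => [em''|nem'']; last first.
  apply: big1 => i _.
  by rewrite linearZ_LR tdiff_funE /tdiff_word (negPf nem'') scaler0.
pose G i j :=
  wsign x i *: (wsign (wdiff x i) j *: tpure m'' (wdiff (wdiff x i) j)).
rewrite (eq_bigr (fun i => \sum_j G i j)); last first.
  move=> i _; rewrite linearZ_LR tdiff_funE /tdiff_word ifT ?scaler_sumr //.
  exact/eqP.
have Gii i : G i i = 0.
  by rewrite /G /wdiff wset_wset wset_eq /dletter /= cc_dd wset0_tpure !scaler0.
have GC i j : (i < j)%N -> G j i = - G i j.
  move=> ij; have ne : i != j by apply: contraTneq ij => ->; rewrite ltnn.
  rewrite /G !wsign_wdiff ij ltnNge (ltnW ij) /= scaleNr scalerN opprK.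
  rewrite !scalerA [_ * wsign x i]mulrC; congr (_ *: tpure _ _).
  rewrite /wdiff (wset_ne _ _ ne) (wset_ne _ _ (_ : j != i)) 1?eq_sym //.
  by rewrite wsetC 1?eq_sym.
have -> : \sum_(i < n) \sum_(j < n) G i j =
    \sum_(i < n) \sum_(j < n | (i < j)%N) G i j +
    \sum_(i < n) \sum_(j < n | (j < i)%N) G i j.
  rewrite -big_split /=; apply: eq_bigr => i _.
  rewrite (bigID (fun j : 'I_n => (i < j)%N)) /=; congr (_ + _).
  rewrite (bigD1 i) ?ltnn //= Gii add0r; apply: eq_bigl => j.
  by rewrite -leqNgt ltn_neqAle andbC.
rewrite [X in _ + X](exchange_big_dep predT) //= -big_split /=.
apply: big1 => i _; rewrite -big_split /=; apply: big1 => j ij.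
by rewrite (GC i j ij) subrr.
Qed.

Lemma tdiff_dd m m' m'' t : tdiff m' m'' (tdiff m m' t) = 0.
Proof.
rewrite -[tdiff m' m'' _]/(tdiff_fun m' m'' (tdiff_fun m m' t)).
elim/tmod_ind: t => [|r x t IH]; first by rewrite !linear0.
by rewrite linearP linearP IH addr0 tdiff_funE tdiff_fun_word scaler0.
Qed.

Definition tpow : chain_complex k := ChainComplex tdiff_dd.

Lemma tpow_dE m x :
  cc_d tpow m (m - 1) (tpure m x) =
    \sum_(i < n) wsign x i *: tpure (m - 1) (wdiff x i).
Proof.
rewrite -[cc_d _ _ _ _]/(tdiff_fun m (m - 1) (tpure m x)) tdiff_funE.
by rewrite /tdiff_word eqxx.
Qed.

(* The Koszul sign of x |-> x \o s: each inversion of s exchanges two letters,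
   of degrees a and b say, at the cost of (-1)^(a b). *)
Definition koszul (s : 'S_n) x : k :=
  \prod_(i < n) \prod_(j < n | (i < j)%N && (s j < s i)%N)
    (-1) ^+ (`|tag (x (s i))| * `|tag (x (s j))|)%N.

Definition wperm (s : 'S_n) x : hword A n := [ffun i => x (s i)].

Definition tact_word (s : 'S_n) m x : tmod A n m :=
  koszul s x *: tpure m (wperm s x).

Lemma tact_word_multilinear s m : multilinear m (tact_word s m).
Proof.
have [ml0 ml] := tpure_multilinear A n m.
split=> [x xm|x i p r u v].
  rewrite /tact_word ml0 ?scaler0 //; apply: contra xm => /eqP <-.
  rewrite /wdeg [X in X == _](reindex_inj (@perm_inj _ s)) /=.
  by apply/eqP/eq_bigr => i _; rewrite ffunE.
have wp (y : {q & A q}) : wperm s (wset x i y) = wset (wperm s x) ((s^-1)%g i) y.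
  by apply/ffunP => j; rewrite !ffunE -{1}(permKV s i) (inj_eq perm_inj).
have ks (u' v' : A p) :
    koszul s (wset x i (Tagged (cc_mod A) u')) =
    koszul s (wset x i (Tagged (cc_mod A) v')).
  have tg j : tag (wset x i (Tagged (cc_mod A) u') j) =
              tag (wset x i (Tagged (cc_mod A) v') j).
    by rewrite !ffunE; case: eqP.
  by apply: eq_bigr => j _; apply: eq_bigr => l _; rewrite !tg.
rewrite /tact_word !wp ml (ks _ v) (ks u v) scalerDr !scalerA.
by rewrite [r * _]mulrC.
Qed.

Definition tact (s : 'S_n) (m : int) : {linear tmod A n m -> tmod A n m} :=
  tlift (tact_word_multilinear s m).

Lemma tactE s m x : tact s m (tpure m x) = koszul s x *: tpure m (wperm s x).
Proof. by rewrite /tact tliftE. Qed.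

End TensorComplex.

Definition thick_map (k : comPzRingType) (A B : chain_complex k) (p : int) :=
  forall n, gmap (tpow A n) (tpow B n) p.

Definition symmetric_thick (k : comPzRingType) (A B : chain_complex k) (p : int)
    (F : thick_map A B p) : Prop :=
  forall n (s : 'S_n) i j (t : tpow A n i),
    F n i j (tact A s i t) = tact B s j (F n i j t).

Record symmetric_thick_contraction (k : comPzRingType) (A B : chain_complex k)
    (F : thick_map A B 0) (G : thick_map B A 0) (H : thick_map A A 1) : Prop :=
  SymmetricThickContraction {
    stc_symf : symmetric_thick F;
    stc_symg : symmetric_thick G;
    stc_symh : symmetric_thick H;
    stc_contr : forall n, contraction (F n) (G n) (H n)
  }.

(* F_1 = f under the identifications tone of A and B with their first tensor
   powers. *)
Definition thick_extends (k : comPzRingType) (A B : chain_complex k) (p : int)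
    (F : thick_map A B p) (f : gmap A B p) : Prop :=
  forall i j (a : A i), F 1%N i j (tone a) = tone (f i j a).

(* Main.v *)
Require Import Defs.
From HB Require Import structures.
From mathcomp Require Import all_boot all_order all_algebra.
From mathcomp Require Import perm ring zify.

Set Implicit Arguments.
Unset Strict Implicit.
Unset Printing Implicit Defensive.

Import GRing.Theory.

(** Let A be the contractible complex with A_i = k for all i and d_i the
    identity for i odd, 0 for i even. A thick contraction of A onto 0 gives an
    equivariant H_n on the n-th tensor power with d H_n + H_n d = -1. If y
    generates A_0, then t = y (x) ... (x) y is an invariant cycle, so that
    u = H_n t is invariant and d u = - t. The coefficient of t in d u is the sum
    of the n coefficients of u at the words with one letter of degree 1 and the
    others of degree 0; these are all equal by invariance, hence n is
    invertible. *)

Section InvariantCycle.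
Local Open Scope ring_scope.
Variable k : comPzRingType.

Definition kmod (i : int) : lmodType k := k^o.

Definition scal_fun (c : int -> int -> k) (i j : int) :
    {linear kmod i -> kmod j} := *:%R (c i j) : {linear k^o -> k^o}.

Definition dcoef (i j : int) : k :=
  if (j == i - 1) && odd `|i|%N then 1 else 0.

(** The value [-1] gives d h + h d = -1, the equation for a contraction onto 0. *)
Definition hcoef (i j : int) : k :=
  if (j == i + 1) && ~~ odd `|i|%N then -1 else 0.

Lemma dcoef_deg i j : j != i + - 1 -> forall a, scal_fun dcoef i j a = 0.
Proof. by move=> /negPf ij a; rewrite /= /dcoef ij scale0r. Qed.

Lemma hcoef_deg i j : j != i + 1 -> forall a, scal_fun hcoef i j a = 0.
Proof. by move=> /negPf ij a; rewrite /= /hcoef ij scale0r. Qed.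

Definition dmap : gmap kmod kmod (- 1) := GMap dcoef_deg.
Definition hmap : gmap kmod kmod 1 := GMap hcoef_deg.

Lemma dmap_dd i j l (a : kmod i) : dmap j l (dmap i j a) = 0.
Proof.
rewrite /= scalerA /dcoef; case: ifP => [/andP[_ oj]|_]; last first.
  by rewrite mul0r scale0r.
case: ifP => [/andP[/eqP ji oi]|_]; last by rewrite mulr0 scale0r.
by exfalso; lia.
Qed.

Definition kcpx : chain_complex k := ChainComplex dmap_dd.

Definition zmod (i : int) : lmodType k := 'rV[k]_0.

Lemma zero_deg (A B : int -> lmodType k) (p i j : int) :
  j != i + p -> forall a : A i, (\0 : {linear A i -> B j}) a = 0.
Proof. by []. Qed.

Definition zmap (A B : int -> lmodType k) p : gmap A B p :=
  GMap (@zero_deg A B p).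

Lemma zmap_dd i j l (a : zmod i) :
  zmap zmod zmod (-1) j l (zmap zmod zmod (-1) i j a) = 0.
Proof. by []. Qed.

Definition zcpx : chain_complex k := ChainComplex zmap_dd.

Lemma zmod0 i (b : zmod i) : b = 0.
Proof. by apply/matrixP => ? []. Qed.

Lemma kcpx_contraction :
  contraction (zmap kcpx zcpx 0) (zmap zcpx kcpx 0) (hmap : gmap kcpx kcpx 1).
Proof.
split=> //.
- by move=> i j a; exact: (zmod0 (i := j)).
- by move=> i j b; rewrite /hom_diff /= !scaler0 subrr.
- move=> i a; rewrite /hom_diff /= !scalerA -scalerBl /hcoef /dcoef.
  rewrite addrK subrK !eqxx /= sub0r -[RHS]scaleN1r; congr (_ *: _).
  have -> : odd `|i + 1| = ~~ odd `|i| by lia.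
  have -> : odd `|i - 1| = ~~ odd `|i| by lia.
  (* One term survives: d h if [i] is even, h d if [i] is odd. *)
  by case: (odd `|i|) => /=; ring.
- by move=> i b; rewrite (zmod0 (i := i) b).
- move=> i j l a; rewrite /= scalerA /hcoef.
  case: ifP => [/andP[_ oj]|_]; last by rewrite mul0r scale0r.
  case: ifP => [/andP[/eqP ji oi]|_]; last by rewrite mulr0 scale0r.
  by exfalso; lia.
- by move=> i j b; rewrite /= scaler0.
Qed.

(** A pure tensor with at least one letter has a zero letter. The power 0 is excluded: it is k, not
    0. *)
Lemma tpow_zcpx0 n m (t : tpow zcpx n.+1 m) : t = 0.
Proof.
elim/tmod_ind: t => [//|r x t ->]; rewrite addr0.
suff -> : x = wset x ord0 (Tagged (cc_mod zcpx) (0 : zcpx (tag (x ord0)))).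
  by rewrite wset0_tpure scaler0.
apply/ffunP => j; rewrite ffunE; case: eqP => // ->.
by case: (x ord0) => p b /=; rewrite (zmod0 (i := p) b).
Qed.

Section Words.
Variable n : nat.
Implicit Types (e : 'I_n -> int) (x : hword kcpx n).

Definition lcoef (p : int) (y : {q : int & kcpx q}) : k :=
  if tag y == p then (tagged y : k) else 0.

(** The tensor power is free with one basis word for each degree sequence [e]; this is the
    coordinate dual to it. *)
Definition wcoef e x : k^o := \prod_(i < n) lcoef (e i) (x i).

Lemma wcoefD1 e x i :
  wcoef e x = lcoef (e i) (x i) * \prod_(j < n | j != i) lcoef (e j) (x j).
Proof. by rewrite /wcoef (bigD1 i). Qed.

Lemma wcoef0 e x i : tag (x i) != e i -> wcoef e x = 0.
Proof. by move=> /negPf xi; rewrite (wcoefD1 e x i) /lcoef xi mul0r. Qed.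

Lemma wcoef_multilinear e m :
  \sum_(i < n) e i = m -> multilinear m (wcoef e).
Proof.
move=> <-; split=> [x xe|x i p r u v].
  have /forallPn[i] : ~~ [forall i, tag (x i) == e i]; last exact: wcoef0.
  by apply: contra xe => /forallP xe; apply/eqP/eq_bigr => i _; apply/eqP.
rewrite !(wcoefD1 e _ i) !wset_eq.
pose P := \prod_(j < n | j != i) lcoef (e j) (x j).
have E y : \prod_(j < n | j != i) lcoef (e j) (wset x i y j) = P.
  by apply: eq_bigr => j ji; rewrite wset_ne.
rewrite !E /lcoef /=; case: eqP => _; last by rewrite !mul0r scaler0 addr0.
by rewrite /GRing.scale /= mulrDl mulrA.
Qed.

Definition tcoef e m (E : \sum_(i < n) e i = m) : {linear tpow kcpx n m -> k^o} :=
  tlift (wcoef_multilinear E).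

Lemma tcoefE e m (E : \sum_(i < n) e i = m) x :
  tcoef E (tpure m x) = wcoef e x.
Proof. exact: tliftE. Qed.

Definition edelta (i j : 'I_n) : int := (j == i)%:Z.

Lemma sum_edelta i : \sum_(j < n) edelta i j = 1.
Proof.
by rewrite (bigD1 i) //= /edelta eqxx big1 // => j /negPf ->.
Qed.

Lemma sum_e0 : \sum_(j < n) (fun=> 0 : int) j = 0.
Proof. by rewrite big1. Qed.

(* No Koszul sign arises since at most one letter of a relevant word has odd
   degree. *)
Lemma tcoef_tact (s : 'S_n) i t :
  tcoef (sum_edelta i) (tact kcpx s 1 t) = tcoef (sum_edelta (s i)) t.
Proof.
elim/tmod_ind: t => [|r x t IH]; first by rewrite !linear0.
rewrite !linearP IH tactE linearZ_LR; congr (_ *: _ + _).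
rewrite !tcoefE.
have [/forallP xs|/forallPn[j xs]] :=
    boolP [forall j, tag (x (s j)) == edelta i j]; last first.
  rewrite (wcoef0 (i := j)) ?ffunE // scaler0 (wcoef0 (i := s j)) //.
  by rewrite /edelta (inj_eq perm_inj).
have -> : koszul s x = 1.
  apply: big1 => a _; apply: big1 => b /andP[ab _].
  rewrite (eqP (xs a)) (eqP (xs b)) /edelta.
  case ai: (a == i); last by rewrite mul0n.
  case bi: (b == i); last by rewrite muln0.
  by rewrite (eqP ai) (eqP bi) ltnn in ab.
rewrite scale1r /wcoef [RHS](reindex_inj (@perm_inj _ s)) /=.
by apply: eq_bigr => j _; rewrite ffunE /edelta (inj_eq perm_inj).
Qed.

(** The differential is the identity from degree 1 to degree 0. *)
Lemma lcoef_dletter y : lcoef 0 (dletter (A := kcpx) y) = lcoef 1 y.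
Proof.
rewrite /lcoef /dletter /= subr_eq0; case: eqP => // ->.
by rewrite /dcoef eqxx /= scale1r.
Qed.

(** Differentiating the [i]-th letter reaches degrees (0, ..., 0) only from [edelta i]; the letters
    before it then have degree 0, so the sign is 1. *)
Lemma tcoef_d t :
  tcoef sum_e0 (cc_d (tpow kcpx n) 1 0 t) = \sum_i tcoef (sum_edelta i) t.
Proof.
elim/tmod_ind: t => [|r x t IH].
  by rewrite !linear0 big1 // => i _; rewrite linear0.
rewrite !linearP IH.
under [RHS]eq_bigr do rewrite linearP.
rewrite big_split -scaler_sumr; congr (_ *: _ + _).
(* The target degree [1 - 1] of [tpow_dE] computes to 0. *)
have -> : cc_d (tpow kcpx n) 1 0 (tpure 1 x) =
    \sum_(i < n) wsign x i *: tpure 0 (wdiff x i) := tpow_dE 1 x.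
rewrite linear_sum; apply: eq_bigr => i _.
rewrite linearZ_LR !tcoefE.
(* If some letter other than the [i]-th has nonzero degree, both coordinates vanish. *)
have [/forallP xi|/forallPn[j]] :=
    boolP [forall j, (j != i) ==> (tag (x j) == 0)]; last first.
  rewrite negb_imply => /andP[ji xj].
  rewrite (wcoef0 (i := j)) ?wset_ne // scaler0 (wcoef0 (i := j)) //.
  by rewrite /edelta (negPf ji).
have -> : wsign x i = 1.
  rewrite /wsign big1 // => j ji; have := xi j.
  by rewrite -val_eqE neq_ltn ji => /eqP ->.
rewrite scale1r !(wcoefD1 _ _ i) wset_eq lcoef_dletter.
rewrite /edelta eqxx; congr (_ * _); apply: eq_bigr => j ji.
by rewrite wset_ne // (negPf ji).
Qed.

Definition yword : hword kcpx n := [ffun=> Tagged (cc_mod kcpx) (1 : kcpx 0)].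

(** All letters are equal, and their degree 0 makes the Koszul sign trivial. *)
Lemma tact_yword s : tact kcpx s 0 (tpure 0 yword) = tpure 0 yword.
Proof.
rewrite tactE; have -> : koszul s yword = 1.
  by apply: big1 => a _; apply: big1 => b _; rewrite !ffunE.
by rewrite scale1r; congr tpure; apply/ffunP => i; rewrite !ffunE.
Qed.

Lemma d_yword : cc_d (tpow kcpx n) 0 (0 - 1) (tpure 0 yword) = 0.
Proof.
rewrite tpow_dE; apply: big1 => i _; rewrite /wdiff ffunE.
have -> : dletter (Tagged (cc_mod kcpx) (1 : kcpx 0)) =
    Tagged (cc_mod kcpx) (0 : kcpx (0 - 1)).
  by rewrite /dletter /= scale0r.
by rewrite wset0_tpure scaler0.
Qed.

Lemma tcoef_yword : tcoef sum_e0 (tpure 0 yword) = 1.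
Proof. by rewrite tcoefE; apply: big1 => i _; rewrite ffunE. Qed.

End Words.

End InvariantCycle.

Theorem proposition8p2 (k : comPzRingType)
  (extend : forall (A B : chain_complex k)
      (f : gmap A B 0) (g : gmap B A 0) (h : gmap A A 1),
    contraction f g h ->
    exists (F : thick_map A B 0) (G : thick_map B A 0) (H : thick_map A A 1),
      [/\ symmetric_thick_contraction F G H,
          thick_extends F f, thick_extends G g & thick_extends H h]) :
  contains_rationals k.
Proof.
have [F [G [H [[_ _ symH contr] _ _ _]]]] := extend _ _ _ _ _ (kcpx_contraction k).
case=> // n _.
pose t := tpure (k := k) 0%R (yword k n.+1).
pose u := H n.+1 0%R 1%R t.
(* In d H t + H d t = G F t - t, the cycle [t] kills H d t, and F t lies in a zero module. *)
have du : (cc_d (tpow (kcpx k) n.+1) 1 0 u = - t)%R.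
  have := contr_dh (contr n.+1) t.
  rewrite (tpow_zcpx0 (F n.+1 _ _ t)) linear0 /hom_diff d_yword linear0.
  by rewrite scaler0 subr0 sub0r.
have inv_u s : tact (kcpx k) s 1 u = u.
  by rewrite -[in LHS]/(H n.+1 0%R 1%R t) -symH tact_yword.
(* The transposition of [ord0] and [i] fixes [u] and exchanges the two coordinates. *)
have coef_u i : tcoef k (sum_edelta i) u = tcoef k (sum_edelta ord0) u.
  by rewrite -{2}(inv_u (tperm ord0 i)) tcoef_tact tpermL.
(* With c the common coordinate, taking the coordinate of d u = - t gives (n + 1) c = -1. *)
exists (- (tcoef k (sum_edelta ord0) u : k))%R.
have := tcoef_d u; rewrite du linearN tcoef_yword.
under eq_bigr do rewrite coef_u.
rewrite sumr_const card_ord => E.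
by rewrite mulrN mulr_natl -[X in (- X)%R]E opprK.
Qed.
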